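(* Given a pair of positive integers $(d,r)$ such that $d\ge 4$ and $$\frac d2\le r\le \frac23(d-1),$$ there is a real line arrangement $\mathcal A$ in $\mathbb P^2$ which is Tjurina maximal of type $(d,r)$.
   Context: A line arrangement $\mathcal A$ in $\mathbb P^2$ (over a field of characteristic zero, e.g. $\mathbb C$) is a finite set of distinct lines, given by $f=0$ with $f\in S=\mathbb K[x,y,z]$ a product of $d$ pairwise non-proportional linear forms; it is real if these linear forms can be chosen with real coefficients. $r(\mathcal A)$ is the minimal degree $r$ for which there is a nonzero triple $(a,b,c)\in S_r^3$ with $af_x+bf_y+cf_z=0$. The global Tjurina number is $\tau(\mathcal A)=\sum_{j\ge 2}n_j(j-1)^2$, where $n_j$ is the number of points lying on exactly $j$ lines of $\mathcal A$. Set $\tau(d,r)_{max}=(d-1)(d-r-1)+r^2$ if $r<d/2$, and $\tau(d,r)_{max}=(d-1)(d-r-1)+r^2-\binom{2r-d+2}{2}$ if $d/2\le r\le d-1$. $\mathcal A$ is called Tjurina maximal (maximal Tjurina) of type $(d,r)$ if it has $d$ lines, $r(\mathcal A)=r$ and $\tau(\mathcal A)=\tau(d,r)_{max}$. *)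

(* Defs.v *)
From HB Require Import structures.
From mathcomp Require Import all_boot all_order all_algebra.
From mathcomp Require Import finmap boolp classical_sets cardinality reals.
From mathcomp Require Import mpoly.
Set Implicit Arguments.
Unset Strict Implicit.
Unset Printing Implicit Defensive.
Import Order.TTheory GRing.Theory Num.Theory.
Local Open Scope ring_scope.

Definition projective_plane (K : fieldType) :=
  {U : {vspace 'rV[K]_3} | \dim U == 1%N}.

(* A finite set of distinct lines of P^2 is given by a choice of equations:
   pairwise non-proportional nonzero linear forms. None of the notions below
   changes when the forms are rescaled or reindexed. *)
Record arrangement (K : fieldType) := Arrangement {
  nlines : nat;
  lform : 'I_nlines -> {mpoly K[3]};
  lform_homog : forall i, lform i \is 1.-homog;
  lform_neq0 : forall i, lform i != 0;
  lform_nonprop : forall i j, i != j -> forall c : K, lform i != c *: lform j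
}.
Arguments lform {K} a i.

Definition defpoly (K : fieldType) (A : arrangement K) : {mpoly K[3]} :=
  \prod_i lform A i.

Definition real_arrangement (R : realType) (K : fieldType)
    (iota : {rmorphism R -> K}) (A : arrangement K) : Prop :=
  forall i, exists2 c : K, c != 0 &
    exists l : {mpoly R[3]}, c *: lform A i = map_mpoly iota l.

Definition on_line (K : fieldType) (l : {mpoly K[3]})
    (p : projective_plane K) : Prop :=
  forall u : 'rV[K]_3, u \in val p -> l.@[fun i => u ord0 i] = 0.

Definition mult_at (K : fieldType) (A : arrangement K)
    (p : projective_plane K) : nat :=
  #|[set i | `[< on_line (lform A i) p >]]|.

(* [fset_set] sends infinite sets to the empty set; only values j >= 2 are used,
   for which the set of points is finite. *)
Definition npoints (K : fieldType) (A : arrangement K) (j : nat) : nat :=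
  #|` fset_set [set p | mult_at A p = j]%classic|.

(* A point lies on at most [nlines A] lines, so the sum stops there. *)
Definition tjurina (K : fieldType) (A : arrangement K) : nat :=
  (\sum_(2 <= j < (nlines A).+1) npoints A j * (j - 1) ^ 2)%N.

Definition has_syzygy (K : fieldType) (f : {mpoly K[3]}) (r : nat) : Prop :=
  exists a : 'I_3 -> {mpoly K[3]},
    [/\ forall i, a i \is r.-homog,
        exists i, a i != 0 &
        \sum_i a i * f^`M(i) = 0].

Definition min_syzygy_degree (K : fieldType) (A : arrangement K) (r : nat) :
    Prop :=
  has_syzygy (defpoly A) r /\
  forall s, has_syzygy (defpoly A) s -> (r <= s)%N.

(* For r <= d - 1 no subtraction on nat is truncated in the selected branch. *)
Definition tau_max (d r : nat) : nat :=
  (if 2 * r < d then (d - 1) * (d - r - 1) + r ^ 2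
   else (d - 1) * (d - r - 1) + r ^ 2 - 'C(2 * r - d + 2, 2))%N.

Definition tjurina_maximal (K : fieldType) (A : arrangement K) (d r : nat) :
    Prop :=
  [/\ nlines A = d, min_syzygy_degree A r & tjurina A = tau_max d r].

(* Main.v *)
From HB Require Import structures.
Require Import Defs.
From mathcomp Require Import all_boot all_order all_algebra.
From mathcomp Require Import finmap boolp classical_sets cardinality reals.
From mathcomp Require Import mpoly ring lra zify.
Set Implicit Arguments.
Unset Strict Implicit.
Unset Printing Implicit Defensive.
Import Order.TTheory GRing.Theory Num.Theory.
Local Open Scope ring_scope.

(** Write [k = d - 2 - r] and [t = 2 r + 1 - d]; the bounds on [r] say exactly
    that [1 <= t <= k + 1], and [d = 2 k + 3 + t], [r = k + 1 + t].  The
    arrangement is a square grid with bars: the line at infinity, the [k + 1]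
    verticals [x = i z], the [k + 1] horizontals [y = j z] ([0 <= i, j <= k]),
    and the [t] parallel diagonals [x - y = c z], [1 <= c <= t].

    Its verticals and the line at infinity pass through [(0 : 1 : 0)], a point of
    multiplicity [k + 2 = d - r], and a point of multiplicity [d - r] gives a
    syzygy of degree [r] ([pencil_syzygy]).  For the rest, add the lines one at
    a time, starting from that pencil.  When a line is added to [m] lines, which
    it meets in [n] distinct points, then
    - the Tjurina number grows by [2 m - n] ([tjurina_sum_cons]), because a point
      of multiplicity [j] on the new line contributes [j ^ 2 - (j - 1) ^ 2];
    - a lower bound [e] for the degree of the syzygies improves to [e + 1],
      provided that [n >= e + 2] ([no_invariant_form_cons]).
    A horizontal meets its predecessors in [k + 2] points ([hor_meets]), and the
    diagonal number [c] in [k + 2 + c] points ([diag_meets]), since it passes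
    through grid points and through the common point at infinity of the earlier
    diagonals.  So every line after the pencil raises the lower bound by one,
    from [0] to [r], and summing the increments gives the maximal Tjurina number.

    The lower bound comes from foliations.  A syzygy [theta] of the partial
    derivatives of [f] is a vector field tangent to every line of [f = 0].
    Instead of working modulo the Euler field [X], use the cross product
    [D = theta * X], that is the 1-form [D . dX] of degree [deg theta + 1], for
    which the lines are invariant: on the line with normal vector [u], [D] is
    proportional to [u].  At the intersection of two lines [D] is proportional
    to two independent vectors, so it vanishes ([invariant_meet]).  If a line
    carries more such points than the degree of [D], then [D] vanishes on it
    ([vanish_on_line]), and dividing [D] by the equation of that line leaves a
    form of smaller degree for which the other lines are still invariant. *)

(** * Dot and cross products of vectors of length three *)

Section Cross.
Variable R : comNzRingType.
Implicit Types u v w : 'rV[R]_3.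

Definition dot u v : R := \sum_i u 0 i * v 0 i.

(** The index arithmetic is that of ['I_3] seen as the integers modulo 3, which
    makes the three components instances of a single formula. *)
Definition cross u v : 'rV[R]_3 :=
  \row_i (u 0 (i + 1) * v 0 (i + 2%:R) - u 0 (i + 2%:R) * v 0 (i + 1)).

Lemma dotC u v : dot u v = dot v u.
Proof. by apply: eq_bigr => i _; rewrite mulrC. Qed.

Lemma dotZl (c : R) u v : dot (c *: u) v = c * dot u v.
Proof. by rewrite /dot mulr_sumr; apply: eq_bigr => i _; rewrite mxE mulrA. Qed.

Lemma dotDr u v w : dot u (v + w) = dot u v + dot u w.
Proof. by rewrite -big_split; apply: eq_bigr => i _; rewrite mxE mulrDr. Qed.

Lemma dotNr u v : dot u (- v) = - dot u v.
Proof. by rewrite -sumrN; apply: eq_bigr => i _; rewrite mxE mulrN. Qed.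

Lemma dotZr c u v : dot u (c *: v) = c * dot u v.
Proof. by rewrite dotC dotZl dotC. Qed.

Lemma dot_delta u i : dot u (delta_mx 0 i) = u 0 i.
Proof.
rewrite /dot (bigD1 i) //= big1 ?addr0 ?mxE ?eqxx ?mulr1 // => j /negPf ne.
by rewrite mxE ne andbF mulr0.
Qed.

Lemma ord3P (P : 'I_3 -> Prop) : P 0 -> P 1 -> P 2%:R -> forall i, P i.
Proof.
move=> P0 P1 P2 [[|[|[|//]]] lt_i].
- by rewrite (_ : Ordinal lt_i = 0) //; apply/val_inj.
- by rewrite (_ : Ordinal lt_i = 1) //; apply/val_inj.
- by rewrite (_ : Ordinal lt_i = 2%:R) //; apply/val_inj.
Qed.

Lemma sum3E (V : zmodType) (F : 'I_3 -> V) : \sum_i F i = F 0 + F 1 + F 2%:R.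
Proof.
rewrite !big_ord_recl big_ord0 addr0 addrA.
by congr (F _ + F _ + F _); apply/val_inj.
Qed.

Lemma ord3D : ((1 + 1 = 2%:R :> 'I_3) * (1 + 2%:R = 0 :> 'I_3) *
  (2%:R + 1 = 0 :> 'I_3) * (2%:R + 2%:R = 1 :> 'I_3)).
Proof. by do !split; apply/val_inj. Qed.

Lemma cross_cross u v w :
  cross (cross u v) w = dot u w *: v - dot v w *: u.
Proof.
apply/rowP; apply: ord3P; rewrite !mxE /dot !sum3E !(add0r, ord3D);
  ring.
Qed.

Lemma dot_cross u v w : dot u (cross v w) = dot (cross u v) w.
Proof. by rewrite /dot !sum3E !mxE !(add0r, ord3D); ring. Qed.

Lemma crossvv u : cross u u = 0.
Proof. by apply/rowP=> i; rewrite !mxE mulrC subrr. Qed.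

Lemma crossC u v : cross u v = - cross v u.
Proof. by apply/rowP=> i; rewrite !mxE; ring. Qed.

Lemma crossDl u v w : cross (u + v) w = cross u w + cross v w.
Proof. by apply/rowP=> i; rewrite !mxE; ring. Qed.

Lemma crossZl c u v : cross (c *: u) v = c *: cross u v.
Proof. by apply/rowP=> i; rewrite !mxE; ring. Qed.
End Cross.

(** * Homogeneous polynomials *)

Section MoreMpoly.
Variables (n : nat) (K : comNzRingType).
Implicit Types P Q : {mpoly K[n]}.

(** Substituting [h i] for ['X_i] changes a polynomial only by an element of the
    ideal of the ['X_i - h i], since the identity and the substitution are ring
    morphisms that agree modulo that ideal on the generators. *)
Lemma comp_mpoly_congr P (h : 'I_n -> {mpoly K[n]}) :
  exists c : 'I_n -> {mpoly K[n]},
    P - (P \mPo [tuple h i | i < n]) = \sum_i c i * ('X_i - h i).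
Proof.
set s := [tuple _ | _ < _].
pose cgr Q := exists c : 'I_n -> {mpoly K[n]},
  Q - (Q \mPo s) = \sum_i c i * ('X_i - h i).
have cgr0 : cgr 0 by exists (fun=> 0); rewrite comp_mpoly0 subrr big1 // => i; rewrite mul0r.
have cgrD A B : cgr A -> cgr B -> cgr (A + B).
  move=> [a Ea] [b Eb]; exists (fun i => a i + b i).
  under eq_bigr do rewrite mulrDl.
  by rewrite big_split -Ea -Eb comp_mpolyD /=; ring.
have cgrM A B : cgr A -> cgr B -> cgr (A * B).
  move=> [a Ea] [b Eb]; exists (fun i => a i * B + (A \mPo s) * b i).
  rewrite (eq_bigr (fun i => B * (a i * ('X_i - h i))
                           + (A \mPo s) * (b i * ('X_i - h i)))); last first.
    by move=> i _; ring.
  by rewrite big_split -!mulr_sumr -Ea -Eb rmorphM /=; ring.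
have cgrC c : cgr c%:MP.
  by exists (fun=> 0); rewrite comp_mpolyC subrr big1 // => i; rewrite mul0r.
have cgrX i : cgr 'X_i.
  exists (fun j => (i == j)%:R); rewrite comp_mpolyXU (bigD1 i) //= eqxx mul1r.
  rewrite big1 ?addr0; last by move=> j /negPf ne; rewrite eq_sym ne mul0r.
  by rewrite (nth_map i) ?size_enum_ord// nth_ord_enum.
elim/mpolyind: P => [//|c m P _ _ IH]; apply: (cgrD) => //.
rewrite -mul_mpolyC; apply: (cgrM); first exact: cgrC.
rewrite mpolyXE_id.
elim/big_rec: _ => [|i A _ cA]; first exact: (cgrC 1).
apply: (cgrM) (cA); elim: (m i) => [|k IHk]; first exact: (cgrC 1).
by rewrite exprS; apply: cgrM (cgrX i) IHk.
Qed.

Lemma pihomogM d e P Q : Q \is e.-homog ->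
  pihomog mdeg (d + e) (P * Q) = pihomog mdeg d P * Q.
Proof.
move=> hQ; have [k le_k] := ubnP (maxn (mmeasure mdeg P) d.+1).
rewrite (@pihomog_partitionE _ _ mdeg k P); last lia.
rewrite mulr_suml !raddf_sum /= mulr_suml; apply: eq_bigr => i _.
have hom : pihomog mdeg i P * Q \is (i + e)%N.-homog by apply: dhomogM => //; apply: pihomogP.
have [->|ne] := eqVneq (i : nat) d.
  by rewrite pihomog_id pihomog_dE //; apply: dhomogM => //; apply: pihomogP.
rewrite (pihomog_ne0 _ hom) ?eqn_add2r //.
by rewrite (pihomog_ne0 ne (pihomogP mdeg i P)) mul0r.
Qed.

Lemma dhomog0C P : P \is 0.-homog -> P = (P@_0%MM)%:MP.
Proof.
move=> hP; apply/mpolyP=> m; rewrite mcoeffC.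
have [->|ne] := eqVneq m 0%MM; first by rewrite mulr1.
by rewrite mulr0; apply: (dhomog_nemf_coeff hP); rewrite /= mdeg_eq0.
Qed.

Lemma meval_dhomog d P (v : 'I_n -> K) (L : {mpoly K[n]}) : P \is d.-homog ->
  P \mPo [tuple v i *: L | i < n] = P.@[v] *: L ^+ d.
Proof.
move=> hP; rewrite [in LHS](mpolyE P) mevalE raddf_sum /= scaler_suml.
apply: eq_big_seq => m mP; rewrite comp_mpolyZ comp_mpolyX.
rewrite -scalerA; congr (_ *: _).
rewrite (eq_bigr (fun i => v i ^+ m i *: L ^+ m i)); last first.
  by move=> i _; rewrite tnth_mktuple exprZn.
rewrite scaler_prod -(dhomog_mf hP mP) /= mdegE.
by rewrite (big_morph _ (exprD L) (expr0 L)).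
Qed.

Lemma mderiv_dhomog d P i : P \is d.+1.-homog -> P^`M(i) \is d.-homog.
Proof.
move=> hP; apply/dhomogP=> m; rewrite mcoeff_msupp mcoeff_mderiv => nz.
have : P@_(m + U_(i)) != 0 by apply: contraNneq nz => ->; rewrite mul0rn.
by rewrite -mcoeff_msupp => /(dhomog_mf hP) /=; rewrite mdegD mdeg1 addn1 => -[].
Qed.

Lemma euler_dhomog d P : P \is d.-homog -> \sum_i 'X_i * P^`M(i) = P *+ d.
Proof.
move=> hP; rewrite {2}(mpolyE P) -sumrMnl.
transitivity (\sum_i \sum_(m <- msupp P) (P@_m *: 'X_[m]) *+ m i).
  apply: eq_bigr => i _; rewrite {1}(mpolyE P) raddf_sum /= mulr_sumr.
  apply: eq_bigr => m _; rewrite mderivZ mderivX scalerA -scalerAr -mpolyXD.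
  have [->|nz] := posnP (m i); first by rewrite mulr0 scale0r.
  rewrite addmC submK; last by rewrite lep1mP -lt0n.
  by rewrite -scalerA scaler_nat -scalerMnr.
rewrite exchange_big /=; apply: eq_big_seq => m mP.
by rewrite -(dhomog_mf hP mP) /= mdegE -sumrMnr.
Qed.
End MoreMpoly.

(** * Lines and points, and divisibility by a linear form *)

Section CrossField.
Variable K : fieldType.
Implicit Types u v w : 'rV[K]_3.

Lemma exists_dot1 u : u != 0 -> exists w, dot w u = 1.
Proof.
case/rV0Pn=> k nz; exists ((u 0 k)^-1 *: delta_mx 0 k).
rewrite /dot (bigD1 k) //= big1 ?addr0; first by rewrite !mxE !eqxx mulr1 mulVf.
by move=> i /negPf ne; rewrite !mxE ne andbF mulr0 mul0r.
Qed.

Lemma dot_nondeg u : (forall w, dot w u = 0) -> u = 0.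
Proof.
move=> all0; apply/eqP/negPn/negP=> /exists_dot1[w].
by rewrite all0 => /esym/eqP; rewrite oner_eq0.
Qed.

Lemma cross_eq0 u v : u != 0 -> cross u v = 0 -> exists c, v = c *: u.
Proof.
case/exists_dot1=> w wu uv0; exists (dot v w).
have := cross_cross u v w; rewrite uv0 [dot u w]dotC wu scale1r.
rewrite (_ : cross 0 w = 0) => [/esym/eqP|]; first by rewrite subr_eq0 => /eqP.
by apply/rowP=> i; rewrite !mxE; ring.
Qed.

Lemma cross_trans n v w : n != 0 -> cross n v = 0 -> cross n w = 0 ->
  cross v w = 0.
Proof.
move=> n0 /(cross_eq0 n0)[a ->] /(cross_eq0 n0)[b ->].
by rewrite crossZl crossC crossZl crossvv scaler0 oppr0 scaler0.
Qed.

Lemma cross_neq0l u v : cross u v != 0 -> u != 0.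
Proof. by apply: contraNneq => ->; apply/eqP/rowP=> i; rewrite !mxE; ring. Qed.

(** Lines are given by normal vectors and points by homogeneous coordinates, so
    this separates distinct lines as well as distinct points. *)
Definition nonprop : rel 'rV[K]_3 := fun u v => cross u v != 0.

Lemma nonprop_sym : ssrbool.symmetric nonprop.
Proof. by move=> u v; rewrite /nonprop crossC oppr_eq0. Qed.

(** Both [v] and [w] are proportional to [cross u u']. *)
Lemma two_lines_meet u u' v w : nonprop u u' ->
  dot u v = 0 -> dot u' v = 0 -> dot u w = 0 -> dot u' w = 0 -> cross v w = 0.
Proof.
move=> nz uv u'v uw u'w.
by apply: (cross_trans nz); rewrite cross_cross ?uv ?u'v ?uw ?u'w !scale0r subr0.
Qed.

(** For [w] on the line [u], the vector [cross v w] is a multiple of [u]; the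
    factor is the value at [w] of the linear form with normal vector
    [cross b v].  Hence that form vanishes at [v] and at no other point of the
    line. *)
Lemma cross_on_line u v w b : dot b u = 1 -> dot u v = 0 ->
  cross v w = dot (cross b v) w *: u + dot u w *: cross v b.
Proof.
move=> bu uv; have := cross_cross (cross v w) u b.
rewrite (cross_cross v w u) (dotC v u) uv scale0r sub0r -scaleNr crossZl.
rewrite (dotC u b) bu scale1r (dotC w u) (dotC _ b) dot_cross scaleNr => E.
by rewrite -[dot u w *: _]opprK E opprB addrC subrK.
Qed.

Definition lin u : {mpoly K[3]} := \sum_i u 0 i *: 'X_i.

Definition coords : 'rV[{mpoly K[3]}]_3 := \row_i 'X_i.

Definition constv (u : 'rV[K]_3) : 'rV[{mpoly K[3]}]_3 := map_mx (mpolyC 3 (R:=K)) u.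

Lemma linE u : lin u = dot (constv u) coords.
Proof. by apply: eq_bigr => i _; rewrite !mxE mul_mpolyC. Qed.

Lemma lin_is_linear : linear lin.
Proof.
move=> c u v; rewrite /lin scaler_sumr -big_split; apply: eq_bigr => i _ /=.
by rewrite !mxE scalerDl scalerA.
Qed.
HB.instance Definition _ := GRing.isLinear.Build K _ _ _ lin lin_is_linear.

Lemma lin_homog u : lin u \is 1.-homog.
Proof. by apply: rpred_sum => i _; apply: rpredZ; rewrite dhomogX /= mdeg1. Qed.

Lemma meval_lin u v : (lin u).@[v 0] = dot u v.
Proof. by rewrite raddf_sum; apply: eq_bigr => i _; rewrite /= mevalZ mevalXU. Qed.

Lemma mcoeff_lin u i : (lin u)@_U_(i) = u 0 i.
Proof.
rewrite raddf_sum (bigD1 i) //= mcoeffZ mcoeffXU eqxx mulr1 big1 ?addr0 //.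
by move=> j ne; rewrite /= mcoeffZ mcoeffXU (negPf ne) mulr0.
Qed.

Lemma lin_inj : injective lin.
Proof. by move=> u v e; apply/rowP=> i; rewrite -!mcoeff_lin e. Qed.

Lemma mderiv_lin u i : (lin u)^`M(i) = (u 0 i)%:MP.
Proof.
rewrite raddf_sum (bigD1 i) //= mderivZ mderivX mnm1E eqxx big1 ?addr0.
  have -> : (U_(i) - U_(i))%MM = 0%MM by apply/mnmP=> j; rewrite mnmBE subnn mnm0E.
  by rewrite scale1r mpolyX0 -mul_mpolyC mulr1.
by move=> j ne; rewrite /= mderivZ mderivX mnm1E (negPf ne) scale0r scaler0.
Qed.

Definition mdvd (P Q : {mpoly K[3]}) := exists A, Q = A * P.

Lemma mdvd0 P : mdvd P 0. Proof. by exists 0; rewrite mul0r. Qed.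

Lemma mdvdD P A B : mdvd P A -> mdvd P B -> mdvd P (A + B).
Proof. by move=> [a ->] [b ->]; exists (a + b); rewrite mulrDl. Qed.

Lemma mdvdM P A B : mdvd P A -> mdvd P (B * A).
Proof. by move=> [a ->]; exists (B * a); rewrite mulrA. Qed.

Lemma mdvd_sum P I (r : seq I) (F : I -> {mpoly K[3]}) :
  (forall i, mdvd P (F i)) -> mdvd P (\sum_(i <- r) F i).
Proof. by move=> dF; apply: big_ind => //; [apply: mdvd0|apply: mdvdD]. Qed.

(** With [dot w u = 1], the projection [x |-> x - u(x) w] onto the plane [u = 0]
    induces an endomorphism of the polynomial ring whose kernel is generated by
    [lin u].  As its values lie in an integral domain, [lin u] is prime. *)
Lemma mdvd_lin_ker u : u != 0 ->
  exists s : 3.-tuple {mpoly K[3]}, forall P, mdvd (lin u) P <-> P \mPo s = 0.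
Proof.
case/exists_dot1=> w wu; exists [tuple 'X_i - (w 0 i)%:MP * lin u | i < 3].
set s := [tuple _ | _ < _]; move=> P; split=> [[A ->]|P0].
  rewrite rmorphM /= (_ : lin u \mPo s = 0) ?mulr0 //.
  rewrite raddf_sum /=.
  rewrite (eq_bigr (fun i => u 0 i *: 'X_i - (w 0 i * u 0 i)%:MP * lin u)); last first.
    move=> i _; rewrite comp_mpolyZ comp_mpolyXU (nth_map i) ?size_enum_ord// nth_ord_enum.
    by rewrite -!mul_mpolyC mpolyCM; ring.
  by rewrite sumrB -mulr_suml -raddf_sum /= -[\sum_i w 0 i * u 0 i]/(dot w u) wu mul1r subrr.
have [c] := comp_mpoly_congr P (fun i => 'X_i - (w 0 i)%:MP * lin u).
rewrite P0 subr0 => ->; apply: mdvd_sum => i; exists (c i * (w 0 i)%:MP).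
by rewrite opprB addrC subrK mulrA.
Qed.

Lemma mdvd_lin_prime u P Q : u != 0 ->
  mdvd (lin u) (P * Q) -> mdvd (lin u) P \/ mdvd (lin u) Q.
Proof.
case/mdvd_lin_ker=> s sP /sP /eqP; rewrite rmorphM mulf_eq0 => /orP[]/eqP e.
  by left; apply/sP.
by right; apply/sP.
Qed.

(** Evaluating at [cross u w], which lies on the line [u], for every [w]. *)
Lemma mdvd_lin u v : mdvd (lin u) (lin v) -> cross u v = 0.
Proof.
case=> A E; rewrite crossC; apply/eqP; rewrite oppr_eq0; apply/eqP.
apply: dot_nondeg => w; rewrite dotC -dot_cross -meval_lin E mevalM meval_lin.
by rewrite dot_cross crossvv /dot big1 ?mulr0 // => i _; rewrite !mxE mul0r.
Qed.

(** The ideal of the point [v] of the line [u] is generated by [lin u] and the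
    equation of a second line through [v].  As [b] satisfies [dot b u = 1], the
    point [b] is not on [u], and the line [cross b v] joining it to [v] can
    serve. *)
Lemma vanish_at_point u v b e (P : {mpoly K[3]}) : dot b u = 1 -> v != 0 ->
  dot u v = 0 -> P \is e.+1.-homog -> P.@[v 0] = 0 ->
  exists A B, B \is e.-homog /\ P = A * lin u + B * lin (cross b v).
Proof.
move=> bu v0 uv hP Pv0; have [a av] := exists_dot1 v0.
have [c] := comp_mpoly_congr P (fun i => v 0 i *: lin a).
rewrite (meval_dhomog _ _ hP) [P.@[_]]Pv0 scale0r subr0 => EP.
(* [a] scales the point: [x - a(x) v] is [cross (cross v x) a], whose entries
   are combinations of [lin u] and [lin (cross b v)] by [cross_on_line] *)
have key i : 'X_i - v 0 i *: lin a =
    lin (cross b v) * (cross u a 0 i)%:MP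
      + lin u * (cross (cross v b) a 0 i)%:MP.
  have -> : 'X_i = lin (delta_mx 0 i).
    rewrite /lin (bigD1 i) //= big1 ?addr0; first by rewrite mxE !eqxx scale1r.
    by move=> j /negPf ne; rewrite mxE ne andbF scale0r.
  rewrite ![_ * _%:MP]mulrC !mul_mpolyC -!linearZ -linearB -linearD /=.
  congr lin; apply/eqP; rewrite -subr_eq0; apply/eqP/dot_nondeg=> w.
  have /rowP/(_ i) := cross_cross v w a.
  rewrite (cross_on_line w bu uv) crossDl !crossZl (dotC v a) av scale1r.
  rewrite !(dotDr, dotNr, dotZr) dot_delta (dotC w u) (dotC w (cross b v)).
  move: (cross u a) (cross (cross v b) a) => p q; rewrite !mxE => E.
  rewrite [v 0 i * _]mulrC -E; ring.
(* the coefficients [c i] need not be homogeneous *)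
exists (pihomog mdeg e (\sum_i c i * (cross (cross v b) a 0 i)%:MP)).
exists (pihomog mdeg e (\sum_i c i * (cross u a 0 i)%:MP)).
split; first exact: pihomogP.
rewrite -!(pihomogM _ _ (lin_homog _)) -raddfD addn1 /= -{1}(pihomog_dE hP).
congr (pihomog _ _ _); rewrite EP !mulr_suml -big_split; apply: eq_bigr => i _ /=.
rewrite key; ring.
Qed.

End CrossField.
Arguments nonprop {K}.

(** * Invariant lines of a homogeneous 1-form *)

Section Foliation.
Variable K : fieldType.
Implicit Types (u v w : 'rV[K]_3) (D : 'rV[{mpoly K[3]}]_3).

Lemma dhomog0_eq0 (P : {mpoly K[3]}) (v : 'I_3 -> K) :
  P \is 0.-homog -> P.@[v] = 0 -> P = 0.
Proof. by move=> /dhomog0C ->; rewrite mevalC => ->; rewrite mpolyC0. Qed.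

(** A form of degree [e] on a projective line with more than [e] zeros is zero.
    By induction on the zeros: modulo [lin u], the polynomial is divisible by a
    linear form that vanishes at the first zero only. *)
Lemma vanish_on_line u (Q : seq 'rV[K]_3) e (P : {mpoly K[3]}) :
  u != 0 -> pairwise nonprop Q ->
  {in Q, forall v, [/\ v != 0, dot u v = 0 & P.@[v 0] = 0]} ->
  P \is e.-homog -> (e < size Q)%N -> mdvd (lin u) P.
Proof.
case/exists_dot1=> b bu; elim: Q e P => [//|v Q IH] [|e] P /= /andP[vQ pQ] hQ hP.
  have [_ _ Pv _] := hQ v (mem_head _ _).
  by rewrite (dhomog0_eq0 hP Pv); apply: mdvd0.
rewrite ltnS => le_e; have [v0 uv Pv] := hQ v (mem_head _ _).
have [A [B [hB EP]]] := vanish_at_point bu v0 uv hP Pv.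
rewrite EP; apply: mdvdD; first by exists A.
rewrite mulrC; apply: mdvdM; apply: (IH e) => // w wQ.
have [|w0 uw Pw] := hQ w; first by rewrite inE wQ orbT.
split=> //; move: Pw; rewrite EP mevalD !mevalM !meval_lin uw mulr0 add0r.
move/eqP; rewrite mulf_eq0 => /orP[/eqP //|/eqP mw].
have /(_ w wQ) := allP vQ; rewrite /nonprop (cross_on_line w bu uv) mw uw !scale0r.
by rewrite addr0 eqxx.
Qed.

(** The form [D . dX] restricts to zero on the line [u] when [D] is proportional
    to [u] there; the line is then invariant under the foliation defined by [D]. *)
Definition invariant D u := forall i, mdvd (lin u) (cross D (constv u) 0 i).

(** A syzygy of degree [e] yields an invariant form of degree [e + 1], so this
    forces every syzygy to have degree at least [r]. *)
Definition no_invariant_form (s : seq 'rV[K]_3) r := forall e D, (e <= r)%N ->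
  (forall i, D 0 i \is e.-homog) -> (forall u, u \in s -> invariant D u) ->
  D = 0.

(** At [v], the vector [D] is proportional to [u] and to [u']. *)
Lemma invariant_meet D u u' v i : nonprop u u' ->
  dot u v = 0 -> dot u' v = 0 -> invariant D u -> invariant D u' ->
  (D 0 i).@[v 0] = 0.
Proof.
move=> uu' uv u'v Du Du'; pose Dv : 'rV[K]_3 := map_mx (meval (v 0)) D.
have invv w : dot w v = 0 -> invariant D w -> cross Dv w = 0.
  move=> wv Dw; apply/rowP=> j; have [A] := Dw j; rewrite !mxE => E.
  have := congr1 (meval (v 0)) E; rewrite mevalM meval_lin wv mulr0.
  by rewrite mevalB !mevalM !mevalC.
suff: Dv = 0 by move/rowP/(_ i); rewrite !mxE.
apply/eqP/negPn/negP=> Dv0; case/negP: uu'; apply/eqP.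
exact: cross_trans Dv0 (invv _ uv Du) (invv _ u'v Du').
Qed.

(** A constant form vanishes as soon as it vanishes at one point. *)
Lemma no_invariant_form0 s u u' : u \in s -> u' \in s -> nonprop u u' ->
  no_invariant_form s 0.
Proof.
move=> us u's uu' [|//] D _ hD Ds; apply/rowP=> i; rewrite mxE.
apply: (dhomog0_eq0 (v := cross u u' 0)) => //.
apply: (invariant_meet i uu' _ _ (Ds u us) (Ds u' u's)).
  by rewrite dot_cross crossvv /dot big1 // => j _; rewrite mxE mul0r.
by rewrite dotC -dot_cross crossvv /dot big1 // => j _; rewrite mxE mulr0.
Qed.

(** [D] vanishes at the [size Q >= r + 2] points of [Q], so it is divisible by
    [lin u].  Since [lin u] is prime to the equations of the other lines, these
    remain invariant for the quotient, whose degree is at most [r]. *)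
Lemma no_invariant_form_cons s u r (Q : seq 'rV[K]_3) : u != 0 ->
  {in s, forall u', nonprop u u'} ->
  pairwise nonprop Q -> (r.+1 < size Q)%N ->
  {in Q, forall v, [/\ v != 0, dot u v = 0 &
     exists2 u', u' \in s & dot u' v = 0]} ->
  no_invariant_form s r -> no_invariant_form (u :: s) r.+1.
Proof.
move=> u0 us pQ ltQ hQ Ns e D le_e hD Ds.
have Du i : mdvd (lin u) (D 0 i).
  apply: (vanish_on_line u0 pQ _ (hD i)); last exact: leq_ltn_trans ltQ.
  move=> v /hQ[v0 uv [u' u's u'v]]; split=> //.
  apply: (invariant_meet i (us _ u's) uv u'v (Ds _ (mem_head _ _))).
  by apply: Ds; rewrite inE u's orbT.
(* in degree 0 there is no quotient to pass to *)
case: e le_e hD => [|e] le_e hD.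
  case: Q hQ {pQ} ltQ => [//|v Q] hQ _; have [v0 uv [u' u's u'v]] := hQ v (mem_head _ _).
  apply/rowP=> i; rewrite mxE; apply: (dhomog0_eq0 (hD i) (v := v 0)).
  apply: (invariant_meet i (us _ u's) uv u'v (Ds _ (mem_head _ _))).
  by apply: Ds; rewrite inE u's orbT.
have /fin_all_exists[D' hD'] i : exists A, A \is e.-homog /\ D 0 i = A * lin u.
  have [A E] := Du i; exists (pihomog mdeg e A); split; first exact: pihomogP.
  by rewrite -(pihomogM _ _ (lin_homog u)) -E addn1 pihomog_dE.
suff D'0 : (\row_i D' i : 'rV_3) = 0.
  apply/rowP=> i; rewrite mxE (proj2 (hD' i)); move/rowP/(_ i): D'0.
  by rewrite !mxE => ->; rewrite mul0r.
apply: (Ns e) => // [i|u' u's i]; first by rewrite mxE; case: (hD' i).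
have u'0 : u' != 0 by have := us _ u's; rewrite -/(nonprop _ _) nonprop_sym => /cross_neq0l.
have /(mdvd_lin_prime u'0)[/mdvd_lin|//] :
   mdvd (lin u') (lin u * cross (\row_i D' i) (constv u') 0 i).
  have := Ds u'; rewrite inE u's orbT => /(_ isT i).
  rewrite !mxE !(proj2 (hD' _)); congr mdvd; ring.
by move=> e0; have := us _ u's; rewrite -/(nonprop _ _) nonprop_sym /nonprop e0 eqxx.
Qed.

End Foliation.

(** * Syzygies of the partial derivatives *)

Section Syzygies.
Variable K : fieldType.
Implicit Types (u v w : 'rV[K]_3) (s : seq 'rV[K]_3).

Definition prod_lin s : {mpoly K[3]} := \prod_(u <- s) lin u.

Lemma prod_lin_homog s : prod_lin s \is (size s).-homog.
Proof.
rewrite /prod_lin; elim: s => [|u s IH]; first by rewrite big_nil; exact: dhomog1.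
by rewrite big_cons -[(size (u :: s))]/(1 + size s)%N; apply: dhomogM (lin_homog _) IH.
Qed.

Lemma lin_neq0 u : u != 0 -> lin u != 0.
Proof. by apply: contraNneq => e; apply/eqP/(@lin_inj K); rewrite e linear0. Qed.

Lemma pairwise_rem (T : eqType) (e : rel T) (r : seq T) x :
  ssrbool.symmetric e -> pairwise e r -> x \in r -> all (e x) (rem x r).
Proof.
move=> se; elim: r => //= y r IH /andP[yr pr]; rewrite inE.
have [-> //|ne] /= := eqVneq x y => xr.
by rewrite se (allP yr _ xr) IH.
Qed.

(** Write [f = lin u * g].  By the Leibniz rule a derivation killing [f] maps
    [lin u] to a polynomial whose product with [g] is divisible by [lin u]; no
    factor of [g] is. *)
Lemma derivation_invariant s (a : 'I_3 -> {mpoly K[3]}) u :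
  pairwise nonprop s -> u \in s -> u != 0 ->
  \sum_i a i * (prod_lin s)^`M(i) = 0 -> mdvd (lin u) (\sum_i a i * (u 0 i)%:MP).
Proof.
move=> ps us u0; have ps' : perm_eq s (u :: rem u s) by exact: perm_to_rem.
have /allP us' := pairwise_rem (@nonprop_sym K) ps us.
rewrite {1}/prod_lin (perm_big _ ps') big_cons -/(prod_lin _) /= => E.
have [||e] := @mdvd_lin_prime _ u (prod_lin (rem u s)) (\sum_i a i * (u 0 i)%:MP) u0.
- exists (- \sum_i a i * (prod_lin (rem u s))^`M(i)).
  apply/eqP; rewrite mulNr -addr_eq0; apply/eqP; rewrite -[RHS]E.
  rewrite mulr_sumr mulr_suml -big_split.
  by apply/eq_bigr=> i _; rewrite /= mderivM mderiv_lin; ring.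
- move: us' {E ps'}; rewrite /prod_lin; elim: (rem u s) => [|v r IH] us'.
    rewrite big_nil => -[A E]; have := congr1 (meval ((0 : 'rV[K]_3) 0)) E.
    rewrite mevalM meval_lin meval1 /dot big1 ?mulr0 => [/eqP|i _]; last by rewrite mxE mulr0.
    by rewrite oner_eq0.
  rewrite big_cons => /(mdvd_lin_prime u0)[/mdvd_lin e|].
    by have := us' v (mem_head _ _); rewrite /nonprop e eqxx.
  by apply: IH => w wr; apply: us'; rewrite inE wr orbT.
- exact: e.
Qed.

(** The cross product of a syzygy with the Euler field is a form for which all
    the lines are invariant.  If it were zero, the syzygy would be proportional
    to the Euler field, which maps the product of the [size s] linear forms to
    [size s] times itself. *)
Lemma syzygy_degree_ge s r e : pairwise nonprop s ->
  {in s, forall u, u != 0} ->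
  (size s)%:R != 0 :> K -> no_invariant_form s r -> has_syzygy (prod_lin s) e ->
  (r <= e)%N.
Proof.
move=> ps s0 d0 Ns [a [ha [i0 ai0] E]]; rewrite leqNgt; apply/negP=> lt_er.
pose D := cross (\row_i a i) (coords K).
have D0 : D = 0.
  apply: (Ns e.+1) => // [i|u us j].
    have hX j : 'X_j \is [in K[3], 1.-homog] by rewrite dhomogX /= mdeg1.
    by rewrite !mxE -(addn1 e); apply: rpredB; apply: dhomogM.
  (* the double cross product expands into [theta(lin u)] times the Euler field
     minus [lin u] times [theta] *)
  rewrite cross_cross [_ 0 j]mxE; apply: mdvdD.
    rewrite !mxE mulrC; apply: mdvdM.
    have := derivation_invariant ps us (s0 _ us) E.
    by congr mdvd; apply: eq_bigr => i _; rewrite !mxE.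
  by rewrite -scaleNr mxE; exists (- a j); rewrite linE [dot (coords K) _]dotC !mxE; ring.
case/negP: ai0; apply/eqP.
have XD i j : 'X_i * a j = 'X_j * a i.
  have := cross_cross (\row_i a i) (coords K) (delta_mx 0 i).
  have -> : cross (\row_i a i) (coords K) = 0 by [].
  rewrite !dot_delta; move/rowP/(_ j); rewrite !mxE.
  rewrite !mul0r subr0 => /esym/eqP; rewrite subr_eq0 => /eqP <-; ring.
have : 'X_i0 * \sum_j a j * (prod_lin s)^`M(j) = a i0 * (prod_lin s *+ size s).
  rewrite -(euler_dhomog (prod_lin_homog s)) !mulr_sumr; apply: eq_bigr => j _.
  by rewrite !mulrA XD [a i0 * _]mulrC.
rewrite E mulr0 => /esym/eqP; rewrite mulf_eq0 => /orP[/eqP //|].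
rewrite -scaler_nat scaler_eq0 (negPf d0) /prod_lin prodf_seq_eq0 => /hasP[u us /=].
by rewrite (negPf (lin_neq0 (s0 _ us))).
Qed.

(** Let [g] be the product of the lines through the coordinate point where only
    ['X_i] is nonzero, and [h] the product of the others.  The vector field
    [h d/dX_i] maps [g * h] to its multiple by [h^`M(i)], and subtracting
    [h^`M(i) / d] times the Euler field yields a syzygy. *)
Lemma pencil_syzygy (g h : {mpoly K[3]}) i d r : d%:R != 0 :> K ->
  g * h \is d.-homog -> h \is r.+1.-homog -> h != 0 -> g^`M(i) = 0 ->
  has_syzygy (g * h) r.+1.
Proof.
move=> d0 hf hh h0 gi.
exists (fun j => (i == j)%:R * h - (d%:R^-1 *: h^`M(i)) * 'X_j); split.
- move=> j; apply: rpredB.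
    by case: (i == j); rewrite ?mul1r ?mul0r ?rpred0.
  rewrite -(addn1 r); apply: dhomogM; last by rewrite dhomogX /= mdeg1.
  by apply: rpredZ; apply: mderiv_dhomog.
- have [hi0|hi0] := eqVneq (h^`M(i)) 0.
    by exists i; rewrite eqxx mul1r hi0 scaler0 mul0r subr0.
  (* any coordinate other than [i] shows only the Euler part *)
  exists (i + 1); rewrite (_ : i == i + 1 = false); last by case: i {gi hi0} => -[|[|[|]]].
  rewrite mul0r sub0r oppr_eq0 mulf_eq0 scaler_eq0 invr_eq0 (negPf d0) (negPf hi0) /=.
  by apply/eqP=> /(congr1 (fun P => P@_U_(i + 1))); rewrite mcoeffXU eqxx mcoeff0 => /eqP; rewrite oner_eq0.
under eq_bigr do rewrite mulrBl.
rewrite sumrB (bigD1 i) //= eqxx mul1r big1 ?addr0; last first.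
  by move=> j /negPf ne; rewrite eq_sym ne !mul0r.
under eq_bigr do rewrite -mulrA.
rewrite -mulr_sumr (euler_dhomog hf) mderivM gi mul0r add0r -scaler_nat.
rewrite -scalerAl -scalerAr scalerA mulVf // scale1r; ring.
Qed.

End Syzygies.

(** * Counting the points of an arrangement *)

Section Points.
Variable K : fieldType.
Implicit Types (u v w : 'rV[K]_3) (p q : projective_plane K) (s : seq 'rV[K]_3).

Definition prep p : 'rV[K]_3 := vpick (val p).

Lemma prep_neq0 p : prep p != 0.
Proof. by rewrite vpick0 -dimv_eq0; case: p => U /= /eqP->. Qed.

Lemma val_prep p : val p = <[prep p]>%VS.
Proof.
apply/esym/eqP; rewrite eqEdim -memvE memv_pick dim_vline prep_neq0.
by case: p => U /= /eqP->.
Qed.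

Definition incident u p := dot u (prep p) == 0.

Lemma on_lineP u p : reflect (on_line (lin u) p) (incident u p).
Proof.
apply: (iffP eqP) => [up v|/(_ (prep p) (memv_pick _))]; last first.
  by move=> e; rewrite -meval_lin -[RHS]e; apply: meval_eq.
rewrite val_prep => /vlineP[c ->].
by rewrite -(mulr0 c) -up -dotZr -meval_lin; apply: meval_eq.
Qed.

Lemma nonprop_prep p q : p != q -> nonprop (prep p) (prep q).
Proof.
apply: contraNneq => /(cross_eq0 (prep_neq0 p))[c e].
apply/eqP/val_inj; rewrite (val_prep p) (val_prep q) e.
apply/eqP; rewrite eq_sym eqEdim !dim_vline prep_neq0 -e prep_neq0 andbT e.
by rewrite -memvE memvZ // memv_line.
Qed.

Lemma dim_vline1 v : v != 0 -> \dim <[v]>%VS == 1%N.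
Proof. by move=> v0; rewrite dim_vline v0. Qed.

Let e0 : 'rV[K]_3 := delta_mx 0 0.

Lemma e0_neq0 : e0 != 0.
Proof. by apply/rV0Pn; exists 0; rewrite mxE !eqxx oner_eq0. Qed.

(** The default value of [insubd] is only taken at [v = 0]. *)
Definition ppoint v : projective_plane K :=
  insubd (Sub <[e0]>%VS (dim_vline1 e0_neq0)
           : projective_plane K) <[v]>%VS.

Lemma val_ppoint v : v != 0 -> val (ppoint v) = <[v]>%VS.
Proof. by move=> v0; rewrite insubdK // -topredE /= dim_vline1. Qed.

Lemma incident_ppoint u v : v != 0 -> incident u (ppoint v) = (dot u v == 0).
Proof.
move=> v0; have : v \in <[prep (ppoint v)]>%VS.
  by rewrite -val_prep val_ppoint // memv_line.
case/vlineP=> c e; rewrite {2}e dotZr mulf_eq0 /incident.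
by have := v0; rewrite e scaler_eq0 => /norP[/negPf->].
Qed.

Lemma ppoint_neq v w : nonprop v w -> ppoint v != ppoint w.
Proof.
move=> vw; have v0 := cross_neq0l vw.
have w0 : w != 0 by move: vw; rewrite -/(nonprop _ _) nonprop_sym => /cross_neq0l.
apply: contraNneq vw => /(congr1 val); rewrite !val_ppoint // => e.
have : w \in <[v]>%VS by rewrite e memv_line.
by case/vlineP=> c ->; rewrite crossC crossZl crossvv scaler0 oppr0.
Qed.

Definition mult s p := count (incident^~ p) s.

(** Homogeneous coordinates instead of points, because the forms of
    [no_invariant_form_cons] are evaluated there. *)
Definition meets_in s u (Q : seq 'rV[K]_3) :=
  [/\ pairwise nonprop Q,
      {in Q, forall v, v != 0},
      {in Q, forall v, dot u v = 0 /\ exists2 u', u' \in s & dot u' v = 0} &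
      {in s, forall u', exists2 v, v \in Q & dot u' v = 0}].

(** Letting [P] be any finite set that contains the multiple points, rather than
    the set of multiple points, allows arrangements to be compared on the same
    [P]: points of multiplicity 0 or 1 contribute nothing. *)
Definition tjurina_sum s T := exists P : seq (projective_plane K),
  [/\ uniq P, forall p, (1 < mult s p)%N -> p \in P &
      \sum_(p <- P) (mult s p - 1) ^ 2 = T]%N.

Lemma tjurina_sum_nil : tjurina_sum [::] 0.
Proof. by exists [::]; split=> //; rewrite big_nil. Qed.

(** Double counting of the incidences: each line of [s] contains exactly one
    point of [Q]. *)
Lemma sum_mult_meets s u Q : {in s, forall u', nonprop u u'} ->
  meets_in s u Q -> (\sum_(p <- map ppoint Q) mult s p = size s)%N.
Proof.
move=> us [pQ Q0 hQ hs].
rewrite (eq_bigr (fun p => \sum_(u' <- s) incident u' p)%N); last first.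
  by move=> p _; rewrite /mult -sum1_count big_mkcond.
rewrite exchange_big /= -sum1_size; apply: eq_big_seq => u' u's.
rewrite big_map; have [v vQ u'v] := hs u' u's.
rewrite (perm_big _ (perm_to_rem vQ)) big_cons big_seq big1 => [|w].
  by rewrite incident_ppoint ?Q0 // u'v eqxx.
move=> wQ; have wQ' := mem_rem wQ; rewrite incident_ppoint ?Q0 //.
have /allP/(_ w wQ) := pairwise_rem (@nonprop_sym K) pQ vQ.
have [u'w|//] := eqVneq (dot u' w) 0.
rewrite /nonprop (two_lines_meet (us _ u's) _ u'v _ u'w) ?eqxx //.
  by case: (hQ v vQ).
by case: (hQ w wQ').
Qed.

(** At a point of [Q] of multiplicity [m] in [s], the contribution grows from
    [(m - 1) ^ 2] to [m ^ 2], that is by [2 m - 1], and the multiplicities add up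
    to [size s].  At the other points of the line [u] it stays zero, since there
    the multiplicity grows from 0 to 1. *)
Lemma tjurina_sum_cons s u Q T : {in s, forall u', nonprop u u'} ->
  meets_in s u Q -> tjurina_sum s T ->
  tjurina_sum (u :: s) (T + 2 * size s - size Q).
Proof.
move=> us mQ [P [uP hP <-]]; have [pQ Q0 hQ hs] := mQ.
have uQ : uniq (map ppoint Q).
  rewrite uniq_pairwise pairwise_map; apply: sub_pairwise pQ => v w.
  exact: ppoint_neq.
pose Pnew := map ppoint Q ++ [seq p <- P | p \notin map ppoint Q].
have memQ p : incident u p -> (0 < mult s p)%N -> p \in map ppoint Q.
  move=> up; rewrite -has_count => /hasP[u' u's u'p].
  have [v vQ u'v] := hs u' u's; apply/mapP; exists v => //; apply/eqP.
  apply: contraT => /nonprop_prep; case/negP; apply/eqP.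
  have v0 := Q0 v vQ.
  apply: (two_lines_meet (us u' u's)); apply/eqP=> //.
    by rewrite -/(incident _ _) incident_ppoint //; case: (hQ v vQ) => ->.
  by rewrite -/(incident _ _) incident_ppoint // u'v.
exists Pnew; split.
- rewrite cat_uniq uQ filter_uniq // andbT; apply/hasPn=> p.
  by rewrite mem_filter => /andP[].
- move=> p; rewrite /mult /= -/(mult s p) mem_cat mem_filter.
  have [//|pQ'] := boolP (p \in map ppoint Q); case: (boolP (incident u p)) => up /=.
    by rewrite add1n ltnS => /(memQ _ up); rewrite (negPf pQ').
  by rewrite add0n; apply: hP.
set qs := map ppoint Q in uQ memQ Pnew *.
(* points of [qs] outside [P] have multiplicity at most 1 in [s] *)
have old : (\sum_(p <- qs) (mult s p - 1) ^ 2 =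
            \sum_(p <- P | p \in qs) (mult s p - 1) ^ 2)%N.
  rewrite -[RHS]big_filter (bigID (mem P)) /= [X in (_ + X)%N]big1 ?addn0.
    rewrite -big_filter; apply: perm_big; apply: uniq_perm; rewrite ?filter_uniq //.
    by move=> p; rewrite !mem_filter andbC.
  move=> p; case: (ltnP 1 (mult s p)) => [/hP->//|le1 _].
  by apply/eqP; rewrite expn_eq0 subn_eq0 le1.
have new : (\sum_(p <- qs) (mult (u :: s) p - 1) ^ 2 + size Q =
            \sum_(p <- qs) (mult s p - 1) ^ 2 + 2 * size s)%N.
  rewrite -(sum_mult_meets us mQ) -/qs -(size_map ppoint) -/qs -sum1_size big_distrr.
  rewrite -!big_split; apply: eq_big_seq => _ /mapP[v vQ ->] /=.
  have [uv [u' u's u'v]] := hQ v vQ.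
  have : (0 < mult s (ppoint v))%N.
    by rewrite -has_count; apply/hasP; exists u'; rewrite //= incident_ppoint ?Q0 ?u'v.
  rewrite /mult /= incident_ppoint ?Q0 // uv eqxx /=.
  case: (count _ _) => // m _; rewrite -!mulnn; lia.
have off : (\sum_(p <- P | p \notin qs) (mult (u :: s) p - 1) ^ 2 =
            \sum_(p <- P | p \notin qs) (mult s p - 1) ^ 2)%N.
  apply: eq_bigr => p pQ'; rewrite /mult /= -/(mult s p).
  case: (boolP (incident u p)) => // up; have [->//|] := posnP (mult s p).
  by move/(memQ _ up); rewrite (negPf pQ').
rewrite big_cat big_filter /= off [in RHS](bigID (mem qs)) /= -old.
by rewrite addnAC -new addnAC addnK.
Qed.
End Points.

(** * The arrangement with given normal vectors *)

Section ArrangementOfNormals.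
Variables (K : fieldType) (s : seq 'rV[K]_3).
Hypotheses (s_neq0 : {in s, forall u, u != 0}) (s_gen : pairwise nonprop s).

Let form (i : 'I_(size s)) := lin s`_i.

Lemma form_homog i : form i \is 1.-homog.
Proof. exact: lin_homog. Qed.

Lemma form_neq0 i : form i != 0.
Proof. by rewrite lin_neq0 // s_neq0 // mem_nth. Qed.

Lemma form_nonprop i j : i != j -> forall c : K, form i != c *: form j.
Proof.
move=> ij c; apply/eqP; rewrite -linearZ => /(@lin_inj K) e.
have : cross s`_i s`_j == 0 by rewrite e crossZl crossvv scaler0.
apply/negP.
have gen := pairwiseP 0 s_gen.
have /orP[lt|lt] : (i < j)%N || (j < i)%N by rewrite -neq_ltn.
  exact: (gen i j (ltn_ord i) (ltn_ord j) lt).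
by rewrite -/(nonprop _ _) nonprop_sym; exact: (gen j i (ltn_ord j) (ltn_ord i) lt).
Qed.

Definition arrangement_of := Arrangement form_homog form_neq0 form_nonprop.

Lemma defpoly_arrangement_of : defpoly arrangement_of = prod_lin s.
Proof. by rewrite /defpoly /prod_lin (big_nth 0) big_mkord. Qed.

Lemma mult_at_arrangement_of p : mult_at arrangement_of p = mult s p.
Proof.
rewrite /mult_at -sum1_card /mult -sum1_count [RHS](big_nth 0) big_mkord.
apply: eq_bigl => i; rewrite inE.
by apply/asboolP/idP => /on_lineP.
Qed.

Lemma tjurina_arrangement_of T : tjurina_sum s T -> tjurina arrangement_of = T.
Proof.
case=> P [uP hP <-]; rewrite /tjurina /=.
have npt j : (1 < j)%N -> npoints arrangement_of j = count (fun p => mult s p == j) P.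
  move=> j1; rewrite /npoints.
  have -> : [set p | mult_at arrangement_of p = j]%classic =
            [set` [fset p in [seq p <- P | mult s p == j]]%fset]%classic.
    apply/seteqP; split=> p /=; rewrite mult_at_arrangement_of inE mem_filter /=.
      by move=> e; rewrite e eqxx hP // e.
    by case/andP=> /eqP.
  rewrite set_fsetK card_fseq undup_id ?filter_uniq // size_filter //.
rewrite (eq_big_nat _ _ (F2 := fun j =>
    (\sum_(p <- P) (mult s p == j) * (mult s p - 1) ^ 2)%N)); last first.
  move=> j /andP[j1 _]; rewrite npt // -sum1_count big_mkcond big_distrl /=.
  by apply: eq_bigr => p _; case: eqP => [->|]; rewrite ?mul1n.
rewrite exchange_big /=; apply: eq_bigr => p _.
have [m1|m1] := leqP (mult s p) 1.
  have -> : ((mult s p - 1) ^ 2 = 0)%N by apply/eqP; rewrite expn_eq0 subn_eq0 m1.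
  by rewrite big1 // => j _; rewrite muln0.
rewrite -big_distrl /= (big_nat_widenl _ 0) //.
rewrite big_mkcond /= (bigD1_seq (mult s p)) ?iota_uniq ?mem_index_iota //=; last first.
  by rewrite ltnS count_size.
rewrite m1 eqxx big1 ?mul1n // => j /negPf ne; by rewrite eq_sym ne; case: ifP.
Qed.

End ArrangementOfNormals.

(** * The barred grid *)

Definition vec3 (F : comNzRingType) (a b c : F) : 'rV[F]_3 :=
  \row_i [:: a; b; c]`_i.

Definition infty (F : comNzRingType) : 'rV[F]_3 := @vec3 F 0 0 1.
Definition vert (F : comNzRingType) (i : nat) : 'rV[F]_3 := @vec3 F 1 0 (- i%:R).
Definition hor (F : comNzRingType) (j : nat) : 'rV[F]_3 := @vec3 F 0 1 (- j%:R).

(** The numbering starts at [c = 0] with the line [x - y = z]: the main diagonal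
    of the grid would pass through one grid point too many. *)
Definition diag (F : comNzRingType) (c : nat) : 'rV[F]_3 := @vec3 F 1 (- 1) (- c.+1%:R).

(** The lines are listed with the last added one first, as the statements about
    adding a line to a list require. *)
Definition stack T (L : nat -> T) n s := map L (rev (iota 0 n)) ++ s.

Definition pencil (F : comNzRingType) k := stack (vert F) k.+1 [:: infty F].
Definition grid (F : comNzRingType) k n := stack (hor F) n (pencil F k).
Definition barred_grid (F : comNzRingType) k t := stack (diag F) t (grid F k k.+1).

Lemma stackS T (L : nat -> T) n s : stack L n.+1 s = L n :: stack L n s.
Proof. by rewrite /stack -addn1 iotaD cats1 rev_rcons. Qed.

Lemma size_stack T (L : nat -> T) n s : size (stack L n s) = (n + size s)%N.
Proof. by rewrite size_cat size_map size_rev size_iota. Qed.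

Lemma stackP (T : eqType) (L : nat -> T) n s x :
  reflect ((exists2 i, (i < n)%N & x = L i) \/ x \in s) (x \in stack L n s).
Proof.
rewrite mem_cat; apply: (iffP orP) => -[H|]; [left|by right|left|by right].
  by case/mapP: H => i; rewrite mem_rev mem_iota; exists i.
by case: H => i lt ->; apply: map_f; rewrite mem_rev mem_iota.
Qed.

Lemma map_stack T T' (f : T -> T') L n s :
  map f (stack L n s) = stack (f \o L) n (map f s).
Proof. by rewrite map_cat -map_comp. Qed.

Lemma dot_vec3 (F : comNzRingType) (a b c a' b' c' : F) :
  dot (vec3 a b c) (vec3 a' b' c') = a * a' + b * b' + c * c'.
Proof. by rewrite /dot sum3E !mxE. Qed.

Lemma map_vec3 (F F' : comNzRingType) (f : {rmorphism F -> F'}) a b c :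
  map_mx f (vec3 a b c) = vec3 (f a) (f b) (f c).
Proof. by apply/rowP; apply: ord3P; rewrite !mxE. Qed.

Lemma map_barred_grid (F F' : comNzRingType) (f : {rmorphism F -> F'}) k t :
  map (map_mx f) (barred_grid F k t) = barred_grid F' k t.
Proof.
rewrite !map_stack /= /infty map_vec3 rmorph0 rmorph1 /barred_grid /grid /pencil /stack.
congr (_ ++ (_ ++ (_ ++ _))); apply: eq_map => i;
  by rewrite /= map_vec3 !(rmorph0, rmorphN, rmorph1, rmorph_nat).
Qed.

Section Construction.
Variable K : fieldType.
Hypothesis natK : forall m n : nat, (m%:R == n%:R :> K) = (m == n).

Lemma nonprop_vec3 (a b c a' b' c' : K) :
  nonprop (vec3 a b c) (vec3 a' b' c') =
  [|| b * c' - c * b' != 0, c * a' - a * c' != 0 | a * b' - b * a' != 0].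
Proof.
have -> : nonprop (vec3 a b c) (vec3 a' b' c') =
   (vec3 (b * c' - c * b') (c * a' - a * c') (a * b' - b * a') != 0).
  congr (_ != 0); apply/rowP; apply: ord3P; rewrite !mxE !(add0r, ord3D) //=.
apply/idP/idP; last first.
  by case/or3P=> nz; apply: contraNneq nz => /rowP e;
    [have := e 0|have := e 1|have := e 2%:R]; rewrite !mxE /= => ->.
apply: contraNT; rewrite !negb_or !negbK => /and3P[/eqP-> /eqP-> /eqP->].
by apply/eqP/rowP; apply: ord3P; rewrite !mxE.
Qed.

(** A line of slope [m] has one point at infinity, and its affine points are
    separated by their abscissas. *)
Lemma affine_points_nonprop (m : K) (y : nat -> K) n :
  pairwise nonprop
    (vec3 1 m 0 :: [seq vec3 x%:R (y x) 1 | x <- iota 0 n]).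
Proof.
rewrite /=; apply/andP; split.
  apply/allP=> _ /mapP[x _ ->]; rewrite nonprop_vec3.
  by apply/or3P/Or32; rewrite mul0r mul1r sub0r oppr_eq0 oner_eq0.
rewrite pairwise_map; have := iota_uniq 0 n; rewrite uniq_pairwise.
apply: sub_pairwise => i j /= ne; rewrite nonprop_vec3.
by apply/or3P/Or32; rewrite mul1r mulr1 subr_eq0 natK eq_sym.
Qed.

Lemma nonprop_vert_infty i : nonprop (vert K i) (infty K).
Proof. by rewrite nonprop_vec3; apply/or3P/Or32; rewrite mulr0 mul1r sub0r oppr_eq0 oner_eq0. Qed.

Lemma nonprop_vert i j : nonprop (vert K i) (vert K j) = (i != j).
Proof. by rewrite nonprop_vec3 !(mul0r, mulr0, mul1r, mulr1, subr0, eqxx, opprK) orbF /= addrC subr_eq0 natK eq_sym. Qed.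

Lemma nonprop_hor_infty j : nonprop (hor K j) (infty K).
Proof. by rewrite nonprop_vec3 !(mul0r, mulr0, mul1r, mulr1, subr0) oner_eq0. Qed.

Lemma nonprop_hor_vert i j : nonprop (hor K j) (vert K i).
Proof. by rewrite nonprop_vec3; apply/or3P/Or33; rewrite !(mul0r, mulr0, mul1r, mulr1, sub0r) oppr_eq0 oner_eq0. Qed.

Lemma nonprop_hor i j : nonprop (hor K i) (hor K j) = (i != j).
Proof. by rewrite nonprop_vec3 !(mul0r, mulr0, mul1r, mulr1, subr0, eqxx, opprK) !orbF /= addrC subr_eq0 natK eq_sym. Qed.

Lemma nonprop_diag_infty c : nonprop (diag K c) (infty K).
Proof. by rewrite nonprop_vec3 !(mul0r, mulr0, mul1r, mulr1, subr0) oppr_eq0 oner_eq0. Qed.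

Lemma nonprop_diag_vert c i : nonprop (diag K c) (vert K i).
Proof. by rewrite nonprop_vec3; apply/or3P/Or33; rewrite !(mul0r, mulr0, mul1r, mulr1, sub0r) oppr_eq0 oppr_eq0 oner_eq0. Qed.

Lemma nonprop_diag_hor c j : nonprop (diag K c) (hor K j).
Proof. by rewrite nonprop_vec3; apply/or3P/Or33; rewrite !(mul0r, mulr0, mul1r, mulr1, subr0) oner_eq0. Qed.

Lemma nonprop_diag i j : nonprop (diag K i) (diag K j) = (i != j).
Proof.
rewrite nonprop_vec3.
rewrite (_ : - 1 * _ - _ = j.+1%:R - i.+1%:R); last by ring.
rewrite (_ : _ - 1 * _ = j.+1%:R - i.+1%:R); last by ring.
rewrite (_ : 1 * _ - _ = 0); last by ring.
by rewrite subr_eq0 natK eqSS eqxx orbF orbb eq_sym.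
Qed.

Implicit Types (u v : 'rV[K]_3) (s Q : seq 'rV[K]_3).

(** The two numerical invariants followed along the construction: [r] bounds the
    degree of the syzygies from below, [T] is the Tjurina number. *)
Definition bounds s r T := [/\ {in s, forall u, u != 0}, pairwise nonprop s,
  no_invariant_form s r & tjurina_sum s T].

Lemma bounds_cons s r T u Q : {in s, forall u', nonprop u u'} ->
  meets_in s u Q -> (r.+1 < size Q)%N -> bounds s r T ->
  bounds (u :: s) r.+1 (T + 2 * size s - size Q).
Proof.
move=> us mQ ltQ [s0 ps Ns Ts]; have [pQ Q0 hQ hs] := mQ.
have u0 : u != 0.
  case: Q ltQ hQ {mQ pQ Q0 hs} => // v Q _ /(_ v (mem_head _ _))[_ [u' u's _]].
  exact: cross_neq0l (us _ u's).
split.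
- by move=> v; rewrite inE => /predU1P[->|/s0].
- by rewrite /= ps andbT; apply/allP.
- apply: (no_invariant_form_cons u0 us pQ ltQ) => // v vQ.
  by have [uv ?] := hQ v vQ; split=> //; apply: Q0.
exact: tjurina_sum_cons.
Qed.

Lemma affine_meets s u (m : K) (y : nat -> K) n :
  let Q := vec3 1 m 0 :: [seq vec3 x%:R (y x) 1 | x <- iota 0 n] in
  {in Q, forall v, dot u v = 0 /\ exists2 u', u' \in s & dot u' v = 0} ->
  {in s, forall u', exists2 v, v \in Q & dot u' v = 0} -> meets_in s u Q.
Proof.
move=> Q hQ hs; split=> //; first exact: affine_points_nonprop.
move=> v; rewrite inE => /predU1P[->|/mapP[x _ ->]]; apply/rV0Pn.
  by exists 0; rewrite mxE oner_eq0.
by exists 2%:R; rewrite mxE oner_eq0.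
Qed.

Lemma pencilP k u :
  reflect (u = infty K \/ exists2 i, (i <= k)%N & u = vert K i) (u \in pencil K k).
Proof.
apply: (iffP (stackP _ _ _ _)) => -[|].
- by case=> i ik ->; right; exists i.
- by rewrite inE => /eqP; left.
- by move=> ->; right; rewrite mem_head.
- by case=> i ik ->; left; exists i.
Qed.

Lemma gridP k n u :
  reflect [\/ u = infty K, exists2 i, (i <= k)%N & u = vert K i |
    exists2 j, (j < n)%N & u = hor K j] (u \in grid K k n).
Proof.
apply: (iffP (stackP _ _ _ _)) => [[?|/pencilP[?|?]]|[?|?|?]].
- exact: Or33.
- exact: Or31.
- exact: Or32.
- by right; apply/pencilP; left.
- by right; apply/pencilP; right.
- by left.
Qed.

Lemma barred_gridP k t u :
  reflect ([\/ u = infty K, exists2 i, (i <= k)%N & u = vert K i |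
    exists2 j, (j <= k)%N & u = hor K j] \/ exists2 c, (c < t)%N & u = diag K c)
  (u \in barred_grid K k t).
Proof.
apply: (iffP (stackP _ _ _ _)) => -[H|H]; [by right| | |by left].
  by left; exact: (gridP k k.+1 u H).
by right; apply/(gridP k k.+1 u).
Qed.

Lemma hor_meets k n : meets_in (grid K k n) (hor K n)
  (vec3 1 0 0 :: [seq vec3 x%:R n%:R 1 | x <- iota 0 k.+1]).
Proof.
apply: affine_meets => [v|u].
  rewrite inE => /predU1P[->|/mapP[x]].
    split; first by rewrite dot_vec3; ring.
    exists (infty K); first by apply/gridP/Or31.
    by rewrite dot_vec3; ring.
  rewrite mem_iota => /andP[_ lex] ->.
  split; first by rewrite dot_vec3; ring.
  exists (vert K x); first by apply/gridP/Or32; exists x.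
  by rewrite dot_vec3; ring.
case/gridP=> [->|[i ik ->]|[j jn ->]].
- exists (vec3 1 0 0); first exact: mem_head.
  by rewrite dot_vec3; ring.
- exists (vec3 i%:R n%:R 1); last by rewrite dot_vec3; ring.
  by rewrite inE; apply/orP; right; apply/mapP; exists i; rewrite ?mem_iota.
- exists (vec3 1 0 0); first exact: mem_head.
  by rewrite dot_vec3; ring.
Qed.

(** The points of the line [x - y = t + 1] with abscissas [0, ..., k] lie on
    verticals, those with ordinates [0, ..., k] on horizontals.  As [t <= k],
    together these are all the integral points with abscissas from [0] to
    [k + t + 1]. *)
Lemma diag_meets k t : (t <= k)%N -> meets_in (barred_grid K k t) (diag K t)
  (vec3 1 1 0 :: [seq vec3 x%:R (x%:R - t.+1%:R) 1 | x <- iota 0 (k + t.+2)]).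
Proof.
move=> tk; apply: affine_meets => [v|u].
  rewrite inE => /predU1P[->|/mapP[x]].
    split; first by rewrite dot_vec3; ring.
    exists (infty K); first by apply/barred_gridP; left; apply/Or31.
    by rewrite dot_vec3; ring.
  rewrite mem_iota => /andP[_ lex] ->.
  split; first by rewrite dot_vec3; ring.
  have [xk|kx] := leqP x k.
    exists (vert K x); first by apply/barred_gridP; left; apply/Or32; exists x.
    by rewrite dot_vec3; ring.
  exists (hor K (x - t.+1)).
    by apply/barred_gridP; left; apply/Or33; exists (x - t.+1)%N => //; lia.
  by rewrite dot_vec3 natrB; [ring|lia].
case/barred_gridP=> [[->|[i ik ->]|[j jk ->]]|[c ct ->]].
- exists (vec3 1 1 0); first exact: mem_head.
  by rewrite dot_vec3; ring.
- exists (vec3 i%:R (i%:R - t.+1%:R) 1); last by rewrite dot_vec3; ring.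
  by rewrite inE; apply/orP; right; apply/mapP; exists i; rewrite ?mem_iota //; lia.
- exists (vec3 (j + t.+1)%:R ((j + t.+1)%:R - t.+1%:R) 1).
    by rewrite inE; apply/orP; right; apply/mapP; exists (j + t.+1)%N; rewrite ?mem_iota //; lia.
  by rewrite dot_vec3 natrD; ring.
- exists (vec3 1 1 0); first exact: mem_head.
  by rewrite dot_vec3; ring.
Qed.

Lemma vert_meets n : meets_in (stack (vert K) n [:: infty K]) (vert K n) [:: vec3 0 1 0].
Proof.
split=> // [v|v|u].
- by rewrite inE => /eqP->; apply/rV0Pn; exists 1; rewrite mxE oner_eq0.
- rewrite inE => /eqP->; split; first by rewrite dot_vec3; ring.
  exists (infty K); last by rewrite dot_vec3; ring.
  by apply/stackP; right; rewrite mem_head.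
move=> su; exists (vec3 0 1 0); first exact: mem_head.
by case/stackP: su => [[i _ ->]|]; last rewrite inE => /eqP->; rewrite dot_vec3; ring.
Qed.

Lemma vert_nonprop_pencil n :
  {in stack (vert K) n [:: infty K], forall u, nonprop (vert K n) u}.
Proof.
move=> u /stackP[[i lt ->]|]; last by rewrite inE => /eqP->; apply: nonprop_vert_infty.
by rewrite nonprop_vert neq_ltn lt orbT.
Qed.

Lemma pencil_tjurina n : tjurina_sum (stack (vert K) n [:: infty K]) (n ^ 2).
Proof.
elim: n => [|n IH]; rewrite ?stackS.
  by apply: (tjurina_sum_cons (Q := [::]) _ _ (tjurina_sum_nil K)); [|split].
have := tjurina_sum_cons (@vert_nonprop_pencil n) (vert_meets n) IH.
by rewrite size_stack -!mulnn /=; congr tjurina_sum; lia.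
Qed.

Lemma pencil_bounds k : bounds (pencil K k) 0 (k.+1 ^ 2).
Proof.
split; last exact: pencil_tjurina.
- move=> u /pencilP[->|[i _ ->]]; apply/rV0Pn; first by exists 2%:R; rewrite mxE oner_eq0.
  by exists 0; rewrite mxE oner_eq0.
- rewrite /pencil; elim: k.+1 => [//|n IH]; rewrite stackS /= IH andbT.
  by apply/allP; apply: vert_nonprop_pencil.
apply: (@no_invariant_form0 _ _ (vert K 0) (infty K)); last exact: nonprop_vert_infty.
  by apply/pencilP; right; exists 0%N.
by apply/pencilP; left.
Qed.

Lemma grid_bounds k n : (n <= k.+1)%N ->
  bounds (grid K k n) n (k.+1 ^ 2 + n * k + n * n.+1).
Proof.
elim: n => [|n IH] lenk; first by rewrite !mul0n !addn0; apply: pencil_bounds.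
have gen : {in grid K k n, forall u, nonprop (hor K n) u}.
  move=> u /gridP[->|[i _ ->]|[j lt ->]].
  - exact: nonprop_hor_infty.
  - exact: nonprop_hor_vert.
  - by rewrite nonprop_hor neq_ltn lt orbT.
have := bounds_cons gen (hor_meets k n) _ (IH (ltnW lenk)).
rewrite /= size_map size_iota !size_stack /= ltnS => /(_ lenk).
by rewrite /grid stackS; congr bounds; lia.
Qed.

Lemma barred_grid_bounds k t : (t <= k.+1)%N ->
  bounds (barred_grid K k t) (k.+1 + t) (3 * k.+1 ^ 2 + t * (3 * k + 2) + 'C(t.+1, 2)).
Proof.
elim: t => [|t IH] letk.
  by have := grid_bounds (leqnn k.+1); rewrite addn0; congr bounds; rewrite bin_small // -!mulnn; lia.
have gen : {in barred_grid K k t, forall u, nonprop (diag K t) u}.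
  move=> u /barred_gridP[[->|[i _ ->]|[j _ ->]]|[c lt ->]].
  - exact: nonprop_diag_infty.
  - exact: nonprop_diag_vert.
  - exact: nonprop_diag_hor.
  - by rewrite nonprop_diag neq_ltn lt orbT.
have := bounds_cons gen (@diag_meets k t letk) _ (IH (ltnW letk)).
rewrite /= size_map size_iota !size_stack /= => /(_ ltac:(lia)).
by rewrite /barred_grid stackS (binS t.+1) bin1 addnS; congr bounds; lia.
Qed.

Lemma prod_lin_mderiv0 s i : {in s, forall u, u 0 i = 0} -> (prod_lin s)^`M(i) = 0.
Proof.
rewrite /prod_lin; elim: s => [|u s IH] s0; first by rewrite big_nil -mpolyC1 mderivC.
rewrite big_cons mderivM mderiv_lin s0 ?mem_head // mpolyC0 mul0r add0r IH ?mulr0 // => v vs.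
by apply: s0; rewrite inE vs orbT.
Qed.

(** The lines of the pencil do not involve the second coordinate, and the degree
    counts the other lines, [k + 1] horizontals and [t] diagonals. *)
Lemma barred_grid_syzygy k t : has_syzygy (prod_lin (barred_grid K k t)) (k.+1 + t).
Proof.
pose others := stack (diag K) t (stack (hor K) k.+1 [::]).
have -> : barred_grid K k t = others ++ pencil K k.
  by rewrite /others /barred_grid /grid /stack cats0 catA.
rewrite /prod_lin big_cat /= mulrC -!/(prod_lin _).
have sz : size others = (k + t).+1 by rewrite !size_stack /=; lia.
have others0 : {in others, forall u, u != 0}.
  move=> u /stackP[[i _ ->]|/stackP[[i _ ->]|//]]; apply/rV0Pn.
    by exists 0; rewrite mxE oner_eq0.
  by exists 1; rewrite mxE oner_eq0.
apply: (@pencil_syzygy _ _ _ 1 (size (pencil K k) + size others)).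
- by rewrite sz addnS (natK _ 0).
- by apply: dhomogM; apply: prod_lin_homog.
- by rewrite -sz; apply: prod_lin_homog.
- rewrite /prod_lin prodf_seq_neq0; apply/allP => u /others0 /=; exact: lin_neq0.
apply: prod_lin_mderiv0 => u /pencilP[->|[i _ ->]]; by rewrite mxE.
Qed.

End Construction.

Lemma map_mpoly_lin (F F' : fieldType) (f : {rmorphism F -> F'}) (u : 'rV[F]_3) :
  map_mpoly f (lin u) = lin (map_mx f u).
Proof.
by rewrite /lin raddf_sum; apply: eq_bigr => i _; rewrite /= map_mpolyZ map_mpolyX mxE.
Qed.

(* K is any field containing the reals, in particular the complex numbers. *)
Theorem theorem4p4 (R : realType) (K : fieldType) (iota : {rmorphism R -> K})
    (d r : nat) (d_gt0 : (0 < d)%N) (r_gt0 : (0 < r)%N) (d_ge4 : (4 <= d)%N)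
    (r_ge : d%:R / 2 <= r%:R :> rat)
    (r_le : r%:R <= 2 / 3 * (d%:R - 1) :> rat) :
  exists A : arrangement K, real_arrangement iota A /\ tjurina_maximal A d r.
Proof.
have natK (m n : nat) : (m%:R == n%:R :> K) = (m == n).
  by rewrite -!(rmorph_nat iota) (inj_eq (fmorph_inj iota)) eqr_nat.
have ge2 : (d <= 2 * r)%N.
  by rewrite -(ler_nat rat) natrM; lra.
have le3 : (3 * r + 2 <= 2 * d)%N.
  by rewrite -(ler_nat rat) natrD !natrM; lra.
have [k [t [dE rE tk t0]]] : exists k t, [/\ d = 2 * k + 3 + t, r = k.+1 + t, t <= k.+1 & 0 < t]%N.
  by exists (d - 2 - r)%N, (2 * r + 1 - d)%N; split; lia.
have [s0 s_gen Ns Ts] := barred_grid_bounds natK tk.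
have sz : size (barred_grid K k t) = d by rewrite !size_stack /=; lia.
exists (arrangement_of s0 s_gen); split.
  move=> i; exists 1; first exact: oner_neq0.
  exists (lin (barred_grid R k t)`_i); rewrite scale1r map_mpoly_lin /=.
  have iR : (i < size (barred_grid R k t))%N.
    by rewrite -(size_map (map_mx iota)) map_barred_grid.
  by rewrite -(nth_map _ 0 (map_mx iota)) // map_barred_grid.
split.
- exact: sz.
- rewrite /min_syzygy_degree defpoly_arrangement_of rE; split; first exact: barred_grid_syzygy.
  move=> e; apply: (syzygy_degree_ge s_gen s0 _ Ns).
  by rewrite sz (natK _ 0) -lt0n.
rewrite (tjurina_arrangement_of s0 s_gen Ts) /tau_max ltnNge ge2 /=.
have -> : (2 * r - d + 2 = t.+1)%N by lia.
have := mul_bin_diag t.+1 1; rewrite bin1 dE rE -!mulnn.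
have -> : (2 * k + 3 + t - 1 = 2 * k.+1 + t)%N by lia.
have -> : (2 * k + 3 + t - (k.+1 + t) - 1 = k.+1)%N by lia.
move: 'C(t.+1, 2) => b bE; rewrite -[LHS](addnK b); congr (_ - _)%N.
by rewrite -addnA addnn -mul2n -bE; lia.
Qed.
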